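(* Let $A$, $Q$, $q$, $\sigma$ and $H_{A,Q}$ be as in the context. Then: (1) The torsion elements of $H_{A,Q}$ form a normal subgroup $T(H_{A,Q})$ of $H_{A,Q}$. The quotient group $H_{A,Q}/T(H_{A,Q})$ is isomorphic to $A$, and $H_{A,Q}\simeq T(H_{A,Q})\rtimes A$. (2) The abelianization $H_{A,Q}/[H_{A,Q},H_{A,Q}]$ is isomorphic to a group of the form $F\times A$, where $F$ is a quotient of $\mathfrak S(Q)$ by a normal subgroup $N_Q$ satisfying $[\mathfrak S(Q),\mathfrak S(Q)]\le N_Q\le [W,W]\cap\mathfrak S(Q)$ with $W=\langle\mathfrak S(Q),\sigma\rangle$. In particular $F$ is a finite abelian group.
   Context: An interval exchange transformation (iet) is a bijection $f:[0,1)\to[0,1)$ for which there is a finite partition of $[0,1)$ into half-open intervals $[a,b)$ on each of which $f$ is a translation. The iets form a group $\mathrm{IET}$ under composition. For $a\in\mathbb R/\mathbb Z$, $R_a\in\mathrm{IET}$ is the rotation $x\mapsto x+a \bmod 1$. For an integer $q\ge 1$ let $I_i=[\frac{i-1}{q},\frac{i}{q})$, $1\le i\le q$. For $\tau$ in the symmetric group $\mathcal S_q$ on $\{1,\dots,q\}$, $E_\tau$ is the iet that is a translation on each $I_i$ with $E_\tau(I_i)=I_{\tau(i)}$. Put $\mathcal G_{1/q}=\{E_\tau:\tau\in\mathcal S_q\}$; the map $\mathfrak S:\mathcal G_{1/q}\to\mathcal S_q$, $E_\tau\mapsto\tau$, is an isomorphism. $\sigma=\sigma_q$ is the $q$-cycle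 $(1,2,\dots,q)\in\mathcal S_q$. Setup: $s,m,q\geq 1$ are integers; $\alpha_1,\dots,\alpha_s\in(\mathbb R/\mathbb Z)\setminus(\mathbb Q/\mathbb Z)$ are $\mathbb Q$-independent (i.e. $\sum n_i\alpha_i=0$ in $\mathbb R/\mathbb Z$ with $n_i\in\mathbb Z$ forces all $n_i=0$; equivalently, for real representatives, $1,\alpha_1,\dots,\alpha_s$ are linearly independent over $\mathbb Q$); $A=\langle\alpha_1,\dots,\alpha_s\rangle\simeq\mathbb Z^s$ is the subgroup of $\mathbb R/\mathbb Z$ they generate; $g_1,\dots,g_m\in\mathcal G_{1/q}$ and $Q=\langle g_1,\dots,g_m\rangle\le\mathcal G_{1/q}$; and $H_{A,Q}=\langle R_{\alpha_1},\dots,R_{\alpha_s},g_1,\dots,g_m\rangle\le\mathrm{IET}$. *)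

(* Defs.v *)
From HB Require Import structures.
From mathcomp Require Import all_boot all_order all_algebra all_fingroup.
From mathcomp Require Import generic_quotient ring_quotient.
From mathcomp Require Import all_classical all_reals.
From mathcomp Require Import lra.
Set Implicit Arguments.
Unset Strict Implicit.
Unset Printing Implicit Defensive.
Import Order.TTheory GRing.Theory Num.Theory.

(** * Possibly infinite groups: subgroups, quotients, semidirect products *)

Section Groups.
Local Open Scope group_scope.

Section Subgroup.
Variables (G : groupType) (K : groupClosed G).

Record sgroup : Type := SGroup { sgroup_val :> G; _ : sgroup_val \in K }.

HB.instance Definition _ := [isSub for sgroup_val].
HB.instance Definition _ := [Choice of sgroup by <:].

Fact sgroup_closed : group_closed K.
Proof. by split=> [|x y xK yK]; [exact: gpred1 | exact: gpredF]. Qed.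

HB.instance Definition _ :=
  SubChoice_isSubGroup.Build G (fun x => x \in K) sgroup sgroup_closed.

End Subgroup.

Section Generated.
Variables (G : groupType) (S : set G).

Definition gensg : {pred G} :=
  fun x => `[< forall K : groupClosed G, (forall y, S y -> y \in K) -> x \in K >].

Fact gensg_mul : mulg_closed gensg.
Proof.
move=> x y /asboolP xS /asboolP yS; apply/asboolP => K SK.
by apply: gpredM; [exact: xS | exact: yS].
Qed.

Fact gensg_one : 1 \in gensg.
Proof. by apply/asboolP => K _; exact: gpred1. Qed.

Fact gensg_inv : invg_closed gensg.
Proof.
by move=> x /asboolP xS; apply/asboolP => K SK; apply: gpredVr; exact: xS.
Qed.

HB.instance Definition _ := isMulClosed.Build G gensg gensg_mul.
HB.instance Definition _ := isMul1Closed.Build G gensg gensg_one.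
HB.instance Definition _ := isInvClosed.Build G gensg gensg_inv.

End Generated.

Definition group_iso (G1 G2 : groupType) : Prop :=
  exists f : {multiplicative G1 -> G2}, bijective f.

Definition torsion (G : groupType) : {pred G} :=
  fun x => `[< exists2 n, (0 < n)%N & x ^+ n = 1 >].

Definition derived (G : groupType) : {pred G} :=
  gensg [set z : G | exists x y, z = [~ x, y]].

End Groups.
Arguments torsion : clear implicits.
Arguments derived : clear implicits.

HB.mixin Record isConjClosed (G : groupType) (S : {pred G}) := {
  gpredJr : forall x y, x \in S -> conjg x y \in S
}.

#[short(type="normalClosed")]
HB.structure Definition NormalClosed (G : groupType) :=
  {S of GroupClosed G S & isConjClosed G S}.

Section MoreGroups.
Local Open Scope quotient_scope.
Local Open Scope group_scope.

Section Derived.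
Variable G : groupType.

HB.instance Definition _ := GroupClosed.on (derived G).

Fact derived_conj (x y : G) : x \in derived G -> x ^ y \in derived G.
Proof.
move=> xD; have -> : x ^ y = x * [~ x, y] by rewrite commgEl mulKVg.
by apply: gpredM => //; apply/asboolP => K; apply; exists x, y.
Qed.

HB.instance Definition _ := isConjClosed.Build G (derived G) derived_conj.

End Derived.

Section Quotient.
Variables (G : groupType) (N : normalClosed G).

Definition coset_equiv (x y : G) : bool := x * y^-1 \in N.

Fact coset_equiv_is_equiv : equiv_class_of coset_equiv.
Proof.
split=> [x|x y|y x z]; rewrite /coset_equiv.
- by rewrite mulgV gpred1.
- by rewrite -[RHS]gpredV invgF.
- by move=> xy yz; rewrite -(mulgVK y x) -mulgA gpredM.
Qed.

Canonical coset_equivRel := EquivRelPack coset_equiv_is_equiv.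
Canonical coset_encModRel := defaultEncModRel coset_equiv.

Definition quotg : Type := {eq_quot coset_equiv}.

HB.instance Definition _ := EqQuotient.on quotg.
HB.instance Definition _ := Choice.on quotg.

Definition quotg_one : quotg := lift_cst quotg 1.
Definition quotg_mul := lift_op2 quotg *%g.
Definition quotg_inv := lift_op1 quotg (fun x : G => x^-1).

Canonical pi_quotg_one_morph := PiConst quotg_one.

Fact coset_equiv_repr (x : G) : x * (repr (\pi_quotg x))^-1 \in N.
Proof. by rewrite -/(coset_equiv _ _) -eqmodE reprK. Qed.

Fact pi_quotg_inv : {morph \pi_quotg : x / x^-1 >-> quotg_inv x}.
Proof.
move=> x; unlock quotg_inv; apply/eqP; rewrite eqmodE /= /coset_equiv.
move: (coset_equiv_repr x); set y := repr _ => xy.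
have -> : x^-1 * y^-1^-1 = ((x * y^-1)^-1) ^ x.
  by rewrite invgF conjgE !mulgA mulgVK invgK.
by apply: gpredJr; rewrite gpredV.
Qed.
Canonical pi_quotg_inv_morph := PiMorph1 pi_quotg_inv.

Fact pi_quotg_mul : {morph \pi_quotg : x y / x * y >-> quotg_mul x y}.
Proof.
move=> x y; unlock quotg_mul; apply/eqP; rewrite eqmodE /= /coset_equiv.
move: (coset_equiv_repr x) (coset_equiv_repr y).
set x' := repr _; set y' := repr _ => xx' yy'.
have -> : x * y * (x' * y')^-1 = (y * y'^-1) ^ x^-1 * (x * x'^-1).
  by rewrite invgM conjgE invgK !mulgA mulgVK.
by apply: gpredM => //; exact: gpredJr.
Qed.
Canonical pi_quotg_mul_morph := PiMorph2 pi_quotg_mul.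

Fact quotg_mulA : associative quotg_mul.
Proof. by move=> x y z; rewrite -[x]reprK -[y]reprK -[z]reprK !piE mulgA. Qed.

Fact quotg_mul1g : left_id quotg_one quotg_mul.
Proof. by move=> x; rewrite -[x]reprK !piE mul1g. Qed.

Fact quotg_mulg1 : right_id quotg_one quotg_mul.
Proof. by move=> x; rewrite -[x]reprK !piE mulg1. Qed.

Fact quotg_mulVg : left_inverse quotg_one quotg_inv quotg_mul.
Proof. by move=> x; rewrite -[x]reprK !piE mulVg. Qed.

Fact quotg_mulgV : right_inverse quotg_one quotg_inv quotg_mul.
Proof. by move=> x; rewrite -[x]reprK !piE mulgV. Qed.

HB.instance Definition _ := isGroup.Build quotg
  quotg_mulA quotg_mul1g quotg_mulg1 quotg_mulVg quotg_mulgV.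

End Quotient.

(** Left action of [B] on [K] by group automorphisms. *)
Record autaction (B K : groupType) := AutAction {
  autact :> B -> K -> K;
  autactM : forall b, {morph autact b : x y / x * y};
  autact1 : forall x, autact 1 x = x;
  autactA : forall b c x, autact (b * c) x = autact b (autact c x)
}.

Section SemidirectProduct.
Variables (B K : groupType) (phi : autaction B K).

Definition semidirect & autaction B K : Type := (K * B)%type.
Local Notation sd := (semidirect phi).

HB.instance Definition _ := Choice.on sd.

Definition sd_mul (x y : sd) : sd := (x.1 * phi x.2 y.1, x.2 * y.2).
Definition sd_one : sd := (1, 1).
Definition sd_inv (x : sd) : sd := (phi x.2^-1 x.1^-1, x.2^-1).

Fact autact_one b : phi b 1 = 1.
Proof. by apply: (mulgI (phi b 1)); rewrite -autactM !mulg1. Qed.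

Fact sd_mulA : associative sd_mul.
Proof.
move=> [k b] [l c] [m d]; rewrite /sd_mul /=.
by rewrite autactM autactA !mulgA.
Qed.

Fact sd_mul1g : left_id sd_one sd_mul.
Proof. by move=> [k b]; rewrite /sd_mul /= autact1 !mul1g. Qed.

Fact sd_mulg1 : right_id sd_one sd_mul.
Proof. by move=> [k b]; rewrite /sd_mul /= autact_one !mulg1. Qed.

Fact sd_mulVg : left_inverse sd_one sd_inv sd_mul.
Proof.
by move=> [k b]; rewrite /sd_mul /sd_inv /= -autactM !mulVg autact_one.
Qed.

Fact sd_mulgV : right_inverse sd_one sd_inv sd_mul.
Proof.
by move=> [k b]; rewrite /sd_mul /sd_inv /= -autactA mulgV autact1 mulgV.
Qed.

HB.instance Definition _ := isGroup.Build sd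
  sd_mulA sd_mul1g sd_mulg1 sd_mulVg sd_mulgV.

End SemidirectProduct.
End MoreGroups.

(** * Interval exchange transformations *)

Section IET.
Variable R : realType.
Local Open Scope classical_set_scope.
Local Open Scope ring_scope.

Record ico01 : Type := Ico01 { ico01_val :> R; _ : ico01_val \in `[0, 1[ }.

HB.instance Definition _ := [isSub for ico01_val].
HB.instance Definition _ := [Choice of ico01 by <:].

Lemma ico01_itv (x : ico01) : 0 <= (x : R) < 1.
Proof. by have := valP x; rewrite in_itv. Qed.

(** [D] is the set of pairs of endpoints of the intervals of the partition and
    [t] gives the translation lengths. *)
Definition is_iet (f : ico01 -> ico01) : Prop :=
  bijective f /\
  exists (D : set (R * R)) (t : R * R -> R),
    [/\ finite_set D,
        partition D (fun p => `[p.1, p.2[%classic) `[0, 1[%classic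
      & forall p, D p -> forall x : ico01,
          (x : R) \in `[p.1, p.2[ -> f x = (x : R) + t p :> R].

Record iet : Type := Iet { iet_fun :> ico01 -> ico01; _ : `[< is_iet iet_fun >] }.

HB.instance Definition _ := [isSub for iet_fun].
HB.instance Definition _ := [Choice of iet by <:].

Lemma ietP (f : iet) : is_iet f.
Proof. exact/asboolP/(valP f). Qed.

Lemma ietE (f g : iet) : (forall x, f x = g x :> R) -> f = g.
Proof. by move=> fg; apply/val_inj/funext => x; apply/val_inj/fg. Qed.

(** Empty intervals may be listed in [D]. *)
Lemma is_ietI (f : ico01 -> ico01) (D : set (R * R)) (t : R * R -> R) :
    bijective f -> finite_set D ->
    (forall p, D p -> forall x : R, x \in `[p.1, p.2[ -> x \in `[0, 1[) ->
    (forall x : ico01, exists2 p, D p & (x : R) \in `[p.1, p.2[) ->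
    (forall p p' (x : R), D p -> D p' -> x \in `[p.1, p.2[ ->
       x \in `[p'.1, p'.2[ -> p = p') ->
    (forall p, D p -> forall x : ico01, (x : R) \in `[p.1, p.2[ ->
       f x = (x : R) + t p :> R) ->
  is_iet f.
Proof.
move=> fbij Dfin Dsub Dcov Ddisj Dt; split=> //.
exists (D `&` [set p | p.1 < p.2]), t; split.
- exact: finite_setIl.
- split.
  + apply/seteqP; split=> [x [p [Dp _]]|x x01]; first exact: Dsub.
    have [p Dp /= xp] := Dcov (Ico01 x01).
    exists p => //; split=> //=; move: xp; rewrite in_itv/= => /andP[].
    exact: le_lt_trans.
  + by move=> p p' [Dp _] [Dp' _] [x [xp xp']]; exact: (Ddisj p p' x).
  + by move=> p [_ /= p12]; exists p.1; rewrite /= in_itv/= lexx.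
- by move=> p [Dp _]; exact: Dt.
Qed.

Lemma is_iet_id : is_iet id.
Proof.
apply: (@is_ietI _ [set (0, 1)] (fun=> 0)) => //.
- by exists id.
- by move=> p -> x.
- by move=> x; exists (0, 1) => //; exact: valP x.
- by move=> p p' x -> ->.
- by move=> p _ x _; rewrite addr0.
Qed.

Lemma is_iet_comp (f g : ico01 -> ico01) :
  is_iet f -> is_iet g -> is_iet (g \o f).
Proof.
move=> [fb [D [t [Df [Dc Dd _] Dt]]]] [gb [E [u [Ef [Ec Ed _] Et]]]].
pose cut (pq : (R * R) * (R * R)) : R * R :=
  (Num.max pq.1.1 (pq.2.1 - t pq.1), Num.min pq.1.2 (pq.2.2 - t pq.1)).
have cutP pq (x : R) : (x \in `[(cut pq).1, (cut pq).2[) =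
    (x \in `[pq.1.1, pq.1.2[) && (x + t pq.1 \in `[pq.2.1, pq.2.2[).
  rewrite !in_itv /= ge_max lt_min lerBlDr ltrBrDr.
  by case: (_ <= x); case: (x < _); case: (_ <= _); case: (_ < _).
have Dsub p (x : R) : D p -> x \in `[p.1, p.2[ -> x \in `[0, 1[.
  move=> Dp xp; suff : `[0, 1[%classic x by [].
  by rewrite -Dc; exists p.
have Dex (x : R) : x \in `[0, 1[ -> exists2 p, D p & x \in `[p.1, p.2[.
  move=> x01; have : `[0, 1[%classic x by [].
  by rewrite -Dc => -[p Dp xp]; exists p.
have Eex (x : R) : x \in `[0, 1[ -> exists2 p, E p & x \in `[p.1, p.2[.
  move=> x01; have : `[0, 1[%classic x by [].
  by rewrite -Ec => -[p Ep xp]; exists p.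
have Duniq p p' (x : R) : D p -> D p' -> x \in `[p.1, p.2[ ->
    x \in `[p'.1, p'.2[ -> p = p'.
  by move=> Dp Dp' xp xp'; apply: Dd => //; exists x.
have Euniq p p' (x : R) : E p -> E p' -> x \in `[p.1, p.2[ ->
    x \in `[p'.1, p'.2[ -> p = p'.
  by move=> Ep Ep' xp xp'; apply: Ed => //; exists x.
have sel r : exists pq, (cut @` (D `*` E)) r ->
    [/\ D pq.1, E pq.2 & cut pq = r].
  have [[pq [? ?] <-]|nr] := pselect ((cut @` (D `*` E)) r).
    by exists pq.
  by exists ((0, 0), (0, 0)) => /nr.
have [w wP] := choice sel.
apply: (@is_ietI _ (cut @` (D `*` E)) (fun r => t (w r).1 + u (w r).2)).
- exact: bij_comp.
- exact/finite_image/finite_setX.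
- move=> _ [pq [Dp _] <-] x; rewrite cutP => /andP[xp _]; exact: Dsub xp.
- move=> x; have [p Dp xp] := Dex x (valP x).
  have [q Eq fxq] := Eex (f x) (valP (f x)).
  exists (cut (p, q)); first by exists (p, q).
  by rewrite cutP xp /= -(Dt p).
- move=> _ _ x [[p q] [Dp Eq] <-] [[p' q'] [Dp' Eq'] <-].
  rewrite !cutP => /andP[xp xq] /andP[xp' xq'].
  have /= pp' := Duniq _ _ _ Dp Dp' xp xp'; subst p'.
  by have /= -> := Euniq _ _ _ Eq Eq' xq xq'.
- move=> r /wP[Dp Eq wr] x; have := cutP (w r) x; rewrite wr => -> /andP[xp xq] /=.
  by rewrite (Et _ Eq) (Dt _ Dp) ?addrA.
Qed.

Lemma is_iet_inv (f g : ico01 -> ico01) :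
  cancel f g -> cancel g f -> is_iet f -> is_iet g.
Proof.
move=> fK gK [_ [D [t [Df [Dc Dd _] Dt]]]].
pose sh (p : R * R) : R * R := (p.1 + t p, p.2 + t p).
have shP p (y : R) :
    (y \in `[(sh p).1, (sh p).2[) = (y - t p \in `[p.1, p.2[).
  by rewrite !in_itv /= lerBrDr ltrBlDr.
have Dsub p (x : R) : D p -> x \in `[p.1, p.2[ -> x \in `[0, 1[.
  move=> Dp xp; suff : `[0, 1[%classic x by [].
  by rewrite -Dc; exists p.
have back p (y : R) : D p -> y - t p \in `[p.1, p.2[ ->
    exists x : ico01, (x : R) = y - t p /\ (f x : R) = y.
  move=> Dp yp; exists (Ico01 (Dsub _ _ Dp yp)); split=> //.
  by rewrite (Dt _ Dp) //= subrK.
have uniq p p' (y : R) : D p -> D p' -> y - t p \in `[p.1, p.2[ ->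
    y - t p' \in `[p'.1, p'.2[ -> p = p'.
  move=> Dp Dp' yp yp'; have [x [xE fxE]] := back _ _ Dp yp.
  have [x' [xE' fxE']] := back _ _ Dp' yp'.
  have xx' : x = x' by apply/(can_inj fK)/val_inj; rewrite /= fxE.
  by apply: Dd => //; exists (y - t p); split=> //=; rewrite -xE xx' xE'.
have sel r : exists p, (sh @` D) r -> D p /\ sh p = r.
  have [[p ? <-]|nr] := pselect ((sh @` D) r); first by exists p.
  by exists (0, 0) => /nr.
have [w wP] := choice sel.
apply: (@is_ietI _ (sh @` D) (fun r => - t (w r))).
- by exists f.
- exact: finite_image.
- move=> _ [p Dp <-] y; rewrite shP => /(back _ _ Dp)[x [_ <-]].
  exact: valP (f x).
- move=> y; have : `[0, 1[%classic (g y : R) by exact: valP (g y).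
  rewrite -Dc => -[p Dp gyp]; exists (sh p); first by exists p.
  by rewrite shP -{1}(gK y) (Dt _ Dp) // addrK.
- move=> _ _ y [p Dp <-] [p' Dp' <-]; rewrite !shP => yp yp'.
  by rewrite (uniq _ _ _ Dp Dp' yp yp').
- move=> r /wP[Dp wr] y; have := shP (w r) y; rewrite wr => -> /(back _ _ Dp)[x [<- fxE]].
  have yE : y = f x by exact: val_inj.
  by rewrite yE fK.
Qed.

Fact iet_one_subproof : `[< is_iet id >].
Proof. exact/asboolP/is_iet_id. Qed.

Fact iet_mul_subproof (f g : iet) : `[< is_iet (g \o f) >].
Proof. exact/asboolP/is_iet_comp/ietP/ietP. Qed.

Fact iet_inv_subproof (f : iet) :
  exists g, cancel f g /\ cancel g f.
Proof. by have [[g fK gK] _] := ietP f; exists g. Qed.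

Definition iet_inv_fun (f : iet) : ico01 -> ico01 :=
  projT1 (cid (iet_inv_subproof f)).

Fact iet_invP (f : iet) : cancel f (iet_inv_fun f) /\ cancel (iet_inv_fun f) f.
Proof. exact: projT2 (cid (iet_inv_subproof f)). Qed.

Fact iet_inv_is_iet (f : iet) : `[< is_iet (iet_inv_fun f) >].
Proof.
by apply/asboolP; have [fK gK] := iet_invP f; exact: is_iet_inv (ietP f).
Qed.

Definition iet_one : iet := Iet iet_one_subproof.
(** As for permutations in the library, products are read from left to right:
    [(f * g) x = g (f x)]. *)
Definition iet_mul (f g : iet) : iet := Iet (iet_mul_subproof f g).
Definition iet_inv (f : iet) : iet := Iet (iet_inv_is_iet f).

Fact iet_mulA : associative iet_mul.
Proof. by move=> f g h; exact: ietE. Qed.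

Fact iet_mul1g : left_id iet_one iet_mul.
Proof. by move=> f; exact: ietE. Qed.

Fact iet_mulg1 : right_id iet_one iet_mul.
Proof. by move=> f; exact: ietE. Qed.

Fact iet_mulVg : left_inverse iet_one iet_inv iet_mul.
Proof. by move=> f; apply: ietE => x /=; rewrite (iet_invP f).2. Qed.

Fact iet_mulgV : right_inverse iet_one iet_inv iet_mul.
Proof. by move=> f; apply: ietE => x /=; rewrite (iet_invP f).1. Qed.

HB.instance Definition _ := isGroup.Build iet
  iet_mulA iet_mul1g iet_mulg1 iet_mulVg iet_mulgV.

End IET.

Section Rotations.
Variable R : realType.
Local Open Scope quotient_scope.
Local Open Scope ring_scope.

Local Notation zint := (GRing.ZmodClosed.clone R (@Num.int_num_subdef R) _).

Definition RmodZ : Type := Quotient.quot zint.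

HB.instance Definition _ := ZmodQuotient.on RmodZ.

Fact frac01_subproof (x : R) : x - (Num.floor x)%:~R \in `[0, 1[.
Proof.
rewrite in_itv /=; have /andP[] := floor_itv x.
by rewrite intrD; lra.
Qed.

Definition frac01 (x : R) : ico01 R := Ico01 (frac01_subproof x).

Lemma frac01_eq (x : R) (y : ico01 R) : x - (y : R) \is a Num.int -> frac01 x = y.
Proof.
case: y => y y01 /= xy; apply/val_inj => /=.
move: y01; rewrite in_itv /= => /andP[y0 y1].
have /intrP[n xyE] := xy.
have -> : Num.floor x = n.
  by apply/floor_def; rewrite intrD; lra.
lra.
Qed.

Lemma frac01_int (x : R) : (frac01 x : R) - x \is a Num.int.
Proof. by rewrite /= addrAC subrr add0r rpredN intr_int. Qed.

Definition rot_fun (a : RmodZ) (x : ico01 R) : ico01 R :=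
  frac01 ((x : R) + (repr a : R)).

Lemma repr_int (r : R) : (repr (\pi_RmodZ r) : R) - r \is a Num.int.
Proof.
have : \pi_RmodZ (repr (\pi_RmodZ r)) == \pi_RmodZ r by rewrite reprK.
rewrite -(Quotient.idealrBE zint). by move=> h; exact: h.
Qed.

Lemma rot_fun_eq (r : R) (x y : ico01 R) :
  (x : R) + r - (y : R) \is a Num.int -> rot_fun (\pi_RmodZ r) x = y.
Proof.
move=> xry; apply: frac01_eq.
have -> : (x : R) + repr (\pi_RmodZ r) - (y : R) =
    (repr (\pi_RmodZ r) - r) + ((x : R) + r - (y : R)) by lra.
by rewrite rpredD ?repr_int.
Qed.

Lemma rot_fun_int (r : R) (x : ico01 R) :
  (rot_fun (\pi_RmodZ r) x : R) - ((x : R) + r) \is a Num.int.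
Proof.
set y := rot_fun _ x.
have -> : (y : R) - ((x : R) + r) =
    ((y : R) - ((x : R) + repr (\pi_RmodZ r))) + (repr (\pi_RmodZ r) - r).
  by lra.
by rewrite rpredD ?repr_int ?frac01_int.
Qed.

Lemma rot_funNK (r : R) :
  cancel (rot_fun (\pi_RmodZ r)) (rot_fun (\pi_RmodZ (- r))).
Proof.
move=> x; apply: rot_fun_eq; have := rot_fun_int r x.
by rewrite opprD addrA addrAC.
Qed.

Fact rot_is_iet (a : RmodZ) : `[< is_iet (rot_fun a) >].
Proof.
apply/asboolP; have [c c01 ->] : exists2 c : R, c \in `[0, 1[ & a = \pi_RmodZ c.
  exists (frac01 (repr a) : R); first exact: frac01_subproof.
  rewrite -[LHS]reprK; apply/eqP; rewrite -(Quotient.idealrBE zint).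
  by rewrite -opprB rpredN; exact: frac01_int.
move: c01; rewrite in_itv /= => /andP[c0 c1].
have rotE (x : ico01 R) : (rot_fun (\pi_RmodZ c) x : R) =
   if (x : R) < 1 - c then (x : R) + c else (x : R) + (c - 1).
  have /andP[x0 x1] := ico01_itv x.
  case: ifPn => xc.
    have y01 : (x : R) + c \in `[0, 1[ by rewrite in_itv /=; lra.
    have -> : rot_fun (\pi_RmodZ c) x = Ico01 y01.
      by apply: rot_fun_eq; rewrite /= subrr.
    by [].
  have y01 : (x : R) + (c - 1) \in `[0, 1[.
    by move: xc; rewrite -leNgt in_itv /=; lra.
  have -> : rot_fun (\pi_RmodZ c) x = Ico01 y01; last by [].
  apply: rot_fun_eq => /=.
  by have -> : (x : R) + c - ((x : R) + (c - 1)) = 1 by lra.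
apply: (@is_ietI _ _ [set (0, 1 - c); (1 - c, 1)]%classic
   (fun p => if p.1 == 0 then c else c - 1)).
- exists (rot_fun (\pi_RmodZ (- c))); first exact: rot_funNK.
  by move=> x; rewrite -[in X in rot_fun X _](opprK c) rot_funNK.
- by rewrite finite_setU; split; exact: finite_set1.
- by move=> p [->|->] x; rewrite !in_itv /=; lra.
- move=> x; have /andP[x0 x1] := ico01_itv x.
  have [xc|xc] := ltP (x : R) (1 - c).
    by exists (0, 1 - c); [left | rewrite in_itv /= x0].
  by exists (1 - c, 1); [right | rewrite in_itv /= xc].
- by move=> p p' x [->|->] [->|->] //; rewrite !in_itv /= => /andP[? ?] /andP[? ?];
    exfalso; lra.
- move=> p [->|->] x; rewrite rotE in_itv /= => /andP[xl xr].
    by rewrite xr eqxx.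
  by rewrite ltNge xl /= ifF //; apply/negbTE; rewrite subr_eq0 gt_eqF.
Qed.

Definition rotation (a : RmodZ) : iet R := Iet (rot_is_iet a).

End Rotations.

Section GridPermutations.
Variables (R : realType) (q : nat).
Local Open Scope ring_scope.

Definition grid_cell (i : nat) : interval R := `[i%:R / q%:R, i.+1%:R / q%:R[.

(** Indices start at [0]: [grid_cell i], for [i : 'I_q], is the [i.+1]-st interval
    of the grid. *)
Definition grid_shift (tau : 'S_q) (x : R) : R :=
  \sum_(i < q | x \in grid_cell i) (((tau i)%:R - i%:R) / q%:R).

Lemma grid_cell_uniq (i j : nat) (x : R) :
  x \in grid_cell i -> x \in grid_cell j -> i = j.
Proof.
rewrite !in_itv /=; have [->|q0] := posnP q.
  by rewrite invr0 !mulr0 => /andP[/le_lt_trans h /h]; rewrite ltxx.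
rewrite !ler_pdivrMr ?ltr0n // !ltr_pdivlMr ?ltr0n //.
move=> /andP[xi1 xi2] /andP[xj1 xj2];
have := le_lt_trans xi1 xj2; have := le_lt_trans xj1 xi2.
by rewrite !ltr_nat !ltnS => ji ij; apply/eqP; rewrite eqn_leq ij ji.
Qed.

Lemma grid_cell_ex (x : R) :
  (0 < q)%N -> x \in `[0, 1[ -> exists i : 'I_q, x \in grid_cell i.
Proof.
rewrite in_itv /= => q0 /andP[x0 x1].
have xq0 : 0 <= x * q%:R by rewrite mulr_ge0.
have /andP[h1 h2] := truncn_itv xq0.
have nq : (Num.truncn (x * q%:R) < q)%N.
  rewrite -(ltr_nat R); apply: le_lt_trans h1 _.
  by rewrite -[ltRHS]mul1r ltr_pM2r // ltr0n.
exists (Ordinal nq).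
by rewrite in_itv /= ler_pdivrMr ?ltr0n // ltr_pdivlMr ?ltr0n // h1 h2.
Qed.

Lemma grid_shiftE (tau : 'S_q) (i : 'I_q) (x : R) : x \in grid_cell i ->
  grid_shift tau x = ((tau i)%:R - i%:R) / q%:R.
Proof.
move=> xi; rewrite /grid_shift (big_pred1 i) // => j.
by apply/idP/eqP => [xj|->//]; apply/val_inj/(grid_cell_uniq xj xi).
Qed.

Lemma grid_shift_cell (tau : 'S_q) (i : 'I_q) (x : R) : x \in grid_cell i ->
  x + grid_shift tau x \in grid_cell (tau i).
Proof.
move=> xi; rewrite (grid_shiftE tau xi).
have q0 : 0 < q%:R :> R by rewrite ltr0n; case: q i xi tau => [[]|].
move: xi; rewrite !in_itv /= !ler_pdivrMr // !ltr_pdivlMr // mulrDl divfK ?gt_eqF //.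
by rewrite -!natr1; lra.
Qed.

Lemma grid_cell_sub (i : 'I_q) (x : R) : x \in grid_cell i -> x \in `[0, 1[.
Proof.
have q0 : 0 < q%:R :> R by rewrite ltr0n; case: q i => [[]|].
rewrite !in_itv /= ler_pdivrMr // ltr_pdivlMr // => /andP[h1 h2].
have iq : i.+1%:R <= q%:R :> R by rewrite ler_nat.
rewrite -(pmulr_lge0 x q0) (le_trans _ h1) //= -(ltr_pM2r q0) mul1r.
exact: lt_le_trans iq.
Qed.

Fact grid_subproof (tau : 'S_q) (x : ico01 R) : (x : R) + grid_shift tau x \in `[0, 1[.
Proof.
have [q0|q0] := posnP q.
  rewrite /grid_shift big1 ?addr0; first exact: valP x.
  by move=> i _; exfalso; move: (ltn_ord i); rewrite [X in (_ < X)%N]q0.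
have [i xi] := grid_cell_ex q0 (valP x).
exact: grid_cell_sub (grid_shift_cell tau xi).
Qed.

Definition grid_fun (tau : 'S_q) (x : ico01 R) : ico01 R :=
  Ico01 (grid_subproof tau x).

Lemma grid_fun1 (x : ico01 R) : grid_fun 1%g x = x.
Proof.
apply: val_inj; rewrite /= /grid_shift big1 ?addr0 // => i _.
by rewrite perm1 subrr mul0r.
Qed.

Lemma grid_funM (s t : 'S_q) (x : ico01 R) :
  grid_fun (s * t)%g x = grid_fun t (grid_fun s x).
Proof.
have [q0|q0] := posnP q.
  have sh0 u y : grid_shift u y = 0.
    by rewrite /grid_shift big1 // => i; move: (ltn_ord i); rewrite [X in (_ < X)%N]q0.
  by apply: val_inj; rewrite /= !sh0 !addr0.
have [i xi] := grid_cell_ex q0 (valP x); apply: val_inj => /=.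
rewrite (grid_shiftE t (grid_shift_cell s xi)) !(grid_shiftE _ xi) permM.
lra.
Qed.

Fact grid_is_iet (tau : 'S_q) : `[< is_iet (grid_fun tau) >].
Proof.
apply/asboolP; have [q0|q0] := posnP q.
  suff -> : grid_fun tau = id by exact: is_iet_id.
  apply/funext => x; apply/val_inj; rewrite /= /grid_shift big1 ?addr0 // => i.
  by move: (ltn_ord i); rewrite [X in (_ < X)%N]q0.
have qR : 0 < q%:R :> R by rewrite ltr0n.
pose e (i : 'I_q) : R * R := (i%:R / q%:R, i.+1%:R / q%:R).
have ecell (i : 'I_q) (x : R) : (x \in `[(e i).1, (e i).2[) = (x \in grid_cell i) by [].
have e1 (i : 'I_q) : (e i).1 \in grid_cell i.
  by rewrite in_itv /= lexx ltr_pM2r ?invr_gt0 // ltr_nat ltnSn.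
apply: (@is_ietI _ _ [set p | exists i, p = e i]%classic (fun p => grid_shift tau p.1)).
- exists (grid_fun tau^-1%g) => x.
    by rewrite -grid_funM mulgV grid_fun1.
  by rewrite -grid_funM mulVg grid_fun1.
- have -> : [set p | exists i, p = e i]%classic = (e @` [set: 'I_q])%classic.
    by apply/seteqP; split=> p [i]; [move=> ->; exists i | move=> _ <-; exists i].
  exact/finite_image/finite_finset.
- by move=> _ [i ->] x; rewrite ecell; exact: grid_cell_sub.
- move=> x; have [i xi] := grid_cell_ex q0 (valP x).
  by exists (e i); [exists i|].
- move=> _ _ x [i ->] [j ->]; rewrite !ecell => xi xj.
  by congr (e _); apply/val_inj/(grid_cell_uniq xi xj).
- move=> _ [i ->] x; rewrite ecell => xi /=.
  by rewrite (grid_shiftE _ xi) (grid_shiftE _ (e1 i)).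
Qed.

Definition grid (tau : 'S_q) : iet R := Iet (grid_is_iet tau).

Lemma grid1 : grid 1%g = 1%g.
Proof. by apply: ietE => x; exact: (congr1 val (grid_fun1 x)). Qed.

Lemma gridM : {morph grid : s t / (s * t)%g}.
Proof.
by move=> s t; apply: ietE => x; exact: (congr1 val (grid_funM s t x)).
Qed.

Lemma grid_inj : injective grid.
Proof.
move=> s t st; apply/permP => i.
have q0 : (0 < q)%N by case: q i {s t st} => [[]|].
have qR : 0 < q%:R :> R by rewrite ltr0n.
have xi : i%:R / q%:R \in grid_cell i.
  by rewrite in_itv /= lexx ltr_pM2r ?invr_gt0 // ltr_nat ltnSn.
have := congr1 (fun f : iet R => f (Ico01 (grid_cell_sub xi)) : R) st.
rewrite /= !(grid_shiftE _ xi) => /addrI/(mulIf _).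
rewrite invr_eq0 gt_eqF // => /(_ isT)/addIr/eqP.
by rewrite eqr_nat => /eqP/val_inj.
Qed.

Definition grid_group : set (iet R) := range grid.

(** For a subgroup [K] of [grid_group], this is the image of [K] under the
    isomorphism [grid tau |-> tau]. *)
Definition grid_perms (K : {pred iet R}) : {set 'S_q} :=
  [set tau | grid tau \in K].

Fact grid_perms_group_set (K : groupClosed (iet R)) : group_set (grid_perms K).
Proof.
apply/group_setP; split=> [|s t]; rewrite !inE; first by rewrite grid1 gpred1.
by move=> sK tK; rewrite gridM gpredM.
Qed.

Canonical grid_perms_group (K : groupClosed (iet R)) : {group 'S_q} :=
  Group (grid_perms_group_set K).

Definition sigma : 'S_q := perm (@ordS_inj q).

Definition groupW (K : groupClosed (iet R)) : {group 'S_q} :=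
  <<sigma |: grid_perms K>>%G.

End GridPermutations.
Arguments grid_group : clear implicits.
Arguments grid_perms {R} q K.
Arguments grid_perms_group {R} q K.
Arguments groupW {R} q K.

Section RotationGridGroups.
Variable R : realType.
Local Open Scope quotient_scope.
Local Open Scope classical_set_scope.
Local Open Scope ring_scope.

Definition QmodZ : set (RmodZ R) :=
  [set \pi_(RmodZ R) r | r in @rational R].

Definition Q_independent s (alpha : 'I_s -> RmodZ R) : Prop :=
  forall n : 'I_s -> int, \sum_(i < s) alpha i *~ n i = 0 -> forall i, n i = 0.

Definition groupA s (alpha : 'I_s -> RmodZ R) :
    groupClosed (Algebra.to_multiplicative (RmodZ R)) :=
  @gensg (Algebra.to_multiplicative (RmodZ R)) (range alpha).

Definition groupQ m (g : 'I_m -> iet R) : groupClosed (iet R) :=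
  gensg (range g).

Definition groupH s m (alpha : 'I_s -> RmodZ R) (g : 'I_m -> iet R) :
    groupClosed (iet R) :=
  gensg (range (fun i => rotation (alpha i)) `|` range g).

End RotationGridGroups.

(* Main.v *)
Require Import Defs.
From HB Require Import structures.
From mathcomp Require Import all_boot all_order all_algebra all_fingroup.
From mathcomp Require Import cyclic commutator generic_quotient ring_quotient.
From mathcomp Require Import all_classical all_reals.
From mathcomp Require Import ring lra zify.
Set Implicit Arguments.
Unset Strict Implicit.
Unset Printing Implicit Defensive.
Local Open Scope group_scope.

(** Write [H] for the group generated by the rotations and by [Q], and call the
    [q] points [x + i / q] modulo 1, for [0 <= i < q], the fibre of [x].
    A rotation [R_a] carries the fibre of [x] to the fibre of [x + a] without
    permuting the indices [i], while a grid permutation [E_tau] preserves every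
    fibre. So every [h] in [H] has an [a] in [A] such that [h] carries, for all
    [x], the fibre of [x] to that of [x + a] ([groupH_fibred]). Two such [a]
    differ by a [q]-torsion element, so they are equal because [A] is
    torsion-free; this gives a morphism [l : H -> A] ([groupH_translation]),
    split by [a |-> R_a].

    An element of the kernel of [l] preserves each fibre, hence has finite order,
    dividing the order of the symmetric group ([fibred_torsion]); conversely
    torsion dies in the torsion-free group [A]. So the kernel is the set of torsion elements, and (1)
    is the splitting of [l].

    For (2), [H] is generated by [Q] and a copy of [A], with [Q] inside the kernel
    of [l], so its abelianization is [A] times the image of [Q], which is
    [Q / (Q :&: [H, H])] ([split_abelianization]). The preimage [N] of [[H, H]] in
    the symmetric group contains the commutators of [Q]. The bound [N <= [W, W]] comes
    from the permutations of indices [h] induces between fibres. Since the base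
    points of the fibres are arbitrary reals, moving [x] to [x + 1 / q] describes
    the same fibre with the indices shifted by [sigma]. Hence [E_tau] permutes the
    indices by a conjugate of [tau] under a power of [sigma], and the class modulo
    [[W, W]] is the same on all fibres. The class is multiplicative on [H]
    ([fibredM]), so it is trivial on [[H, H]], whereas on [E_tau] it is the class
    of [tau]. *)

(** * Subgroups and quotients of possibly infinite groups *)

(** Functions obtained by choice below are only known to be multiplicative; this
    packages them as group morphisms. *)
Lemma gmorph_of_mulM (G B : groupType) (f : G -> B) :
  {morph f : x y / x * y} -> exists h : UMagmaMorphism.type G B, h =1 f.
Proof.
move=> fM; have f1 : f 1 = 1 by apply: (mulgI (f 1)); rewrite -fM !mulg1.
pose h : UMagmaMorphism.type G B := HB.pack f
  (isMultiplicative.Build G B f fM) (Multiplicative_isUMagmaMorphism.Build G B f f1).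
by exists h.
Qed.

Lemma sgroupP (G : groupType) (K : groupClosed G) (x : sgroup K) : \val x \in K.
Proof. exact: (valP x). Qed.

Lemma gensg_ind (G : groupType) (S : set G) (P : G -> Prop) :
    P 1 -> (forall x y, P x -> P y -> P (x * y)) ->
    (forall x, P x -> P x^-1) -> (forall x, S x -> P x) ->
  forall x, x \in gensg S -> P x.
Proof.
move=> P1 PM PV PS x /asboolP xS.
pose K : {pred G} := fun y => `[< P y >].
have KM : mulg_closed K.
  by move=> y z /asboolP Py /asboolP Pz; apply/asboolP/PM.
have K1 : 1 \in K by apply/asboolP.
have KV : invg_closed K by move=> y /asboolP Py; apply/asboolP/PV.
pose KK : groupClosed G := HB.pack K (isMulClosed.Build G K KM)
  (isMul1Closed.Build G K K1) (isInvClosed.Build G K KV).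
by apply/asboolP/(xS KK) => y Sy; apply/asboolP/PS.
Qed.

Lemma gensg_gen (G : groupType) (S : set G) x : S x -> x \in gensg S.
Proof. by move=> Sx; apply/asboolP => K; apply. Qed.

Lemma gensg_sub (G : groupType) (S : set G) (K : groupClosed G) :
  (forall x, S x -> x \in K) -> {subset gensg S <= K}.
Proof. by move=> SK x /asboolP; apply. Qed.

(** The property may involve the membership proof, as is needed to state facts
    about elements of a generated subgroup seen as a group of its own. *)
Lemma sgroup_gensg_ind (G : groupType) (S : set G) (P : sgroup (gensg S) -> Prop) :
    P 1 -> (forall x y, P x -> P y -> P (x * y)) ->
    (forall x, P x -> P x^-1) -> (forall x, S (\val x) -> P x) ->
  forall x, P x.
Proof.
move=> P1 PM PV PS x.
suff [y yx Py] : exists2 y : sgroup (gensg S), \val y = \val x & P y.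
  by rewrite -(val_inj yx).
apply: (@gensg_ind _ S (fun z => exists2 y : sgroup (gensg S), \val y = z & P y));
  last exact: valP x.
- by exists 1.
- by move=> _ _ [y <- Py] [z <- Pz]; exists (y * z); [exact: valM | exact: PM].
- by move=> _ [y <- Py]; exists y^-1; [exact: gmulfV | exact: PV].
- move=> z Sz; have zS := gensg_gen Sz.
  exists (@SGroup G (gensg S) z zS) => //; exact: PS.
Qed.

Section Kernel.
Variables (G B : groupType) (f : UMagmaMorphism.type G B).

Definition kerg : {pred G} := fun x => f x == 1.

Fact kerg_mul : mulg_closed kerg.
Proof.
by move=> x y /eqP fx /eqP fy; rewrite unfold_in; apply/eqP; rewrite gmulfM fx fy mulg1.
Qed.

Fact kerg_one : 1 \in kerg.
Proof. by rewrite unfold_in gmulf1. Qed.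

Fact kerg_inv : invg_closed kerg.
Proof. by move=> x /eqP fx; rewrite unfold_in gmulfV fx invg1. Qed.

HB.instance Definition _ := isMulClosed.Build G kerg kerg_mul.
HB.instance Definition _ := isMul1Closed.Build G kerg kerg_one.
HB.instance Definition _ := isInvClosed.Build G kerg kerg_inv.

Fact kerg_conj (x y : G) : x \in kerg -> x ^ y \in kerg.
Proof. by move=> /eqP fx; rewrite unfold_in gmulfJ fx conj1g. Qed.

HB.instance Definition _ := isConjClosed.Build G kerg kerg_conj.

End Kernel.

Section Quotient.
Local Open Scope quotient_scope.
Variables (G : groupType) (N : normalClosed G).

Lemma pi_quotgM : {morph (\pi_(quotg N) : G -> quotg N) : x y / x * y}.
Proof. exact: pi_quotg_mul. Qed.

Lemma pi_quotg_eq1 (x : G) : (\pi_(quotg N) x == 1 :> quotg N) = (x \in N).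
Proof.
have -> : (1 : quotg N) = \pi_(quotg N) 1.
  by rewrite -[LHS]/(quotg_one N) [quotg_one N]piE.
by rewrite eqmodE /= /coset_equiv invg1 mulg1.
Qed.

(** First isomorphism theorem: [f] is constant on the classes modulo [N], so it may
    be evaluated at the chosen representatives. *)
Lemma quotg_iso (B : groupType) (f : UMagmaMorphism.type G B) :
    (forall b, exists x, f x = b) -> (forall x, (x \in N) = (f x == 1)) ->
  group_iso (quotg N) B.
Proof.
move=> fsurj fN; pose F (u : quotg N) := f (repr u).
have FE x : F (\pi_(quotg N) x) = f x.
  have := coset_equiv_repr N x; rewrite fN /F gmulfF.
  by move/eqP/divg1_eq.
have FM : {morph F : u v / u * v}.
  by move=> u v; rewrite -[u]reprK -[v]reprK -pi_quotgM !FE gmulfM.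
have [h hE] := gmorph_of_mulM FM.
exists h; have [s sK] := choice fsurj.
exists (fun b => \pi_(quotg N) (s b)) => [u|b].
  rewrite hE -[u]reprK FE; apply/eqP; rewrite eqmodE /= /coset_equiv fN.
  by rewrite gmulfF sK mulgV.
by rewrite hE FE sK.
Qed.

End Quotient.

Lemma commg_derived (G : groupType) (x y : G) : [~ x, y] \in derived G.
Proof. by apply: gensg_gen; exists x, y. Qed.

Lemma abelianization_commute (G : groupType) (u v : quotg (derived G)) :
  commute u v.
Proof.
apply/commgP; rewrite -[u]reprK -[v]reprK.
have [p pE] := gmorph_of_mulM (@pi_quotgM _ (derived G)).
by rewrite -!pE -gmulfR pE pi_quotg_eq1 commg_derived.
Qed.

(** * Split extensions and their abelianization *)

Section Split.
Variables (G B : groupType) (l : UMagmaMorphism.type G B).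
Variables (s : UMagmaMorphism.type B G) (sK : cancel s l).

Lemma split_quotient : group_iso (quotg (kerg l)) B.
Proof. by apply: (quotg_iso (f := l)) => // b; exists (s b). Qed.

Fact split_act_subproof (b : B) (k : sgroup (kerg l)) :
  \val k ^ (s b)^-1 \in kerg l.
Proof. by apply: gpredJr; exact: valP k. Qed.

(** [B] acts on the kernel by conjugation through the section; the inverse makes
    it a left action for products read from left to right. *)
Definition split_act_fun (b : B) (k : sgroup (kerg l)) : sgroup (kerg l) :=
  SGroup (split_act_subproof b k).

Fact split_actM b : {morph split_act_fun b : x y / x * y}.
Proof. by move=> x y; apply: val_inj; rewrite [LHS]conjMg. Qed.

Fact split_act1 x : split_act_fun 1 x = x.
Proof. by apply: val_inj; rewrite /= gmulf1 invg1 conjg1. Qed.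

Fact split_actA b c x :
  split_act_fun (b * c) x = split_act_fun b (split_act_fun c x).
Proof. by apply: val_inj; rewrite /= gmulfM invgM conjgM. Qed.

Definition split_act : autaction B (sgroup (kerg l)) :=
  AutAction split_actM split_act1 split_actA.

Fact split_part_subproof x : x * (s (l x))^-1 \in kerg l.
Proof. by rewrite unfold_in gmulfF sK mulgV. Qed.

(** The isomorphism splits [x] into its kernel part [x * (s (l x))^-1] and its
    image [l x]. *)
Lemma split_semidirect : group_iso G (semidirect split_act).
Proof.
pose F (x : G) : semidirect split_act := (SGroup (split_part_subproof x), l x).
have FM : {morph F : x y / x * y}.
  move=> x y; congr (_, _); last exact: gmulfM.
  apply: val_inj; rewrite /= !gmulfM invgM conjgE invgK !mulgA.
  by rewrite mulgVK.
have [h hE] := gmorph_of_mulM FM.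
exists h; exists (fun u : semidirect split_act => \val u.1 * s u.2) => [x|[k b]].
  by rewrite hE /= mulgVK.
have kE : l (\val k) = 1 by apply/eqP; exact: valP k.
have lE : l (\val k * s b) = b by rewrite gmulfM kE mul1g sK.
rewrite hE; congr (_, _); last exact: lE.
by apply: val_inj; rewrite /= lE mulgK.
Qed.

(** From here on, [G] is generated by the section and by a copy [e] of a finite
    group [Q] lying in the kernel. Morphism laws of [e] are only required on [Q],
    so that [e] may take arbitrary values elsewhere. *)
Variables (gT : finGroupType) (Q : {group gT}) (e : gT -> G).
Hypothesis eM : {in Q &, {morph e : x y / x * y}}.
Hypothesis le1 : {in Q, forall t, l (e t) = 1}.
Hypothesis comB : forall b c : B, commute b c.
Hypothesis gen : forall x, x \in gensg ([set e t | t in [set` Q]] `|` range s)%classic.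

Definition derived_preim : {set gT} := [set t in Q | e t \in derived G].

Fact emb1 : e 1 = 1.
Proof. by apply: (mulgI (e 1)); rewrite -eM ?group1 // !mulg1. Qed.

Fact embV t : t \in Q -> e t^-1 = (e t)^-1.
Proof. by move=> tQ; apply: (mulgI (e t)); rewrite -eM ?groupV // !mulgV emb1. Qed.

Fact derived_preim_group_set : group_set derived_preim.
Proof.
apply/group_setP; split=> [|x y]; first by rewrite inE group1 emb1 gpred1.
rewrite !inE => /andP[xQ xD] /andP[yQ yD].
by rewrite groupM //= eM // gpredM.
Qed.

Canonical derived_preim_group := Group derived_preim_group_set.
Local Notation N := derived_preim_group.

Lemma derived_preim_comm : [~: Q, Q] \subset N.
Proof.
rewrite gen_subG; apply/fintype.subsetP => _ /imset2P[x y xQ yQ ->].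
rewrite inE groupR //= /commg /conjg !(eM, embV, groupM, groupV) //.
exact: commg_derived.
Qed.

Lemma derived_preim_normal : N <| Q.
Proof.
apply: sub_der1_normal; first exact: derived_preim_comm.
by apply/fintype.subsetP => x; rewrite inE => /andP[].
Qed.

Lemma derived_preim_abelian : abelian (Q / N).
Proof. by apply: sub_der1_abelian; exact: derived_preim_comm. Qed.

(** As [G^ab] is commutative, the generating set shows that each [x] has the class
    of [e t * s b] for some [t] in [Q]. Here [b] is [l x], because [l] kills
    [derived G]; so the class of [e t] is determined by [x], which determines [t]
    modulo the preimage of [derived G]. The isomorphism sends [x] to the class
    of [t] and to [l x]. *)
Lemma split_abelianization :
  group_iso (quotg (derived G)) (subg_of (Q / N) * B)%type.
Proof.
have [p pE] := gmorph_of_mulM (@pi_quotgM _ (derived G)).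
have pD x : (x \in derived G) = (p x == 1) by rewrite pE pi_quotg_eq1.
have lD : forall x, x \in derived G -> l x = 1.
  apply: gensg_ind => [|x y lx ly|x lx|_ [x [y ->]]].
  - exact: gmulf1.
  - by rewrite gmulfM lx ly mulg1.
  - by rewrite gmulfV lx invg1.
  - by rewrite gmulfR; apply/eqP/commgP/comB.
(* normal form of [x] in the abelianization *)
have dec x : exists t, t \in Q /\ p x = p (e t) * p (s (l x)).
  move: x (gen x); apply: gensg_ind => [|x y [t [tQ xE]] [u [uQ yE]]|x [t [tQ xE]]|x].
  - by exists 1; split; rewrite // emb1 !gmulf1 mulg1.
  - exists (t * u); split; first by rewrite groupM.
    rewrite !gmulfM xE yE eM // gmulfM -!mulgA; congr (_ * _).
    by rewrite !mulgA; congr (_ * _); exact: abelianization_commute.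
  - exists t^-1; split; first by rewrite groupV.
    rewrite !gmulfV xE embV // gmulfV invgM; exact: abelianization_commute.
  - move=> [[t /= tQ <-]|[b _ <-]].
      by exists t; rewrite le1 // !gmulf1 mulg1.
    by exists 1; rewrite group1 emb1 sK gmulf1 mul1g.
have [t tP] := choice dec.
have tQ x : t x \in Q by have [] := tP x.
have tE x : p x = p (e (t x)) * p (s (l x)) by have [] := tP x.
have nNQ : Q \subset 'N(N) := normal_norm derived_preim_normal.
have NQ u : u \in Q -> u \in 'N(N) by exact: (fintype.subsetP nNQ).
have cosE u v : u \in Q -> v \in Q -> p (e u) = p (e v) -> coset N u = coset N v.
  move=> uQ vQ uv; apply/rcoset_kercosetP; rewrite ?NQ // mem_rcoset.
  by rewrite inE groupM ?groupV //= eM ?groupV // embV // pD gmulfF uv mulgV.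
have pet x : p (e (t x)) = p x * (p (s (l x)))^-1 by rewrite [p x]tE mulgK.
pose F (x : G) : (subg_of (Q / N) * B)%type := (subg (Q / N) (coset N (t x)), l x).
have cQ u : u \in Q -> coset N u \in Q / N by exact: mem_quotient.
have FM : {morph F : x y / x * y}.
  move=> x y; congr (_, _); last exact: gmulfM.
  rewrite -[RHS]subgM ?cQ // -morphM ?NQ //; congr (subg _ _).
  apply: cosE; rewrite ?groupM // eM // gmulfM !pet !gmulfM invgM.
  rewrite !mulgA -mulgA; set a := p x; set b := p y.
  set c := (p (s (l y)))^-1; set d := (p (s (l x)))^-1.
  rewrite (abelianization_commute c d) mulgA; congr (_ * _).
  by rewrite -!mulgA; congr (_ * _); exact: abelianization_commute.
have [h hE] := gmorph_of_mulM FM.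
apply: (quotg_iso (f := h)) => [[u b]|x].
  have /morphimP[v vN vQ uE] : sgval u \in Q / N by exact: subgP.
  have lE : l (e v * s b) = b by rewrite gmulfM le1 // mul1g sK.
  exists (e v * s b); rewrite hE; congr (_, _); last exact: lE.
  rewrite -[RHS]sgvalK uE; congr (subg _ _); apply: cosE => //.
  by rewrite pet lE gmulfM mulgK.
rewrite hE; apply/idP/eqP => [xD|[ct lx]].
  congr (_, _); last exact: lD.
  have -> : coset N (t x) = coset N 1.
    apply: cosE; rewrite ?group1 // pet lD // emb1 !gmulf1 invg1 mulg1.
    by apply/eqP; rewrite -pD.
  by rewrite morph1; apply: val_inj; rewrite /= subgK.
have := congr1 sgval ct; rewrite subgK ?cQ // => /coset_idr.
by move/(_ (NQ _ (tQ x))); rewrite inE tQ /= !pD [p x]tE lx !gmulf1 mulg1.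
Qed.

End Split.

(** * The circle and its rotations *)

Section Torus.
Variable R : realType.
Local Open Scope quotient_scope.
Local Open Scope ring_scope.
Import Order.TTheory GRing.Theory Num.Theory.
Local Notation pi := (\pi_(RmodZ R)).

Lemma eq_piP (x y : R) : reflect (pi x = pi y) (x - y \is a Num.int).
Proof.
pose zint := GRing.ZmodClosed.clone R (@Num.int_num_subdef R) _.
apply: (iffP idP) => [xy|/eqP].
  by apply/eqP; rewrite -(Quotient.idealrBE zint); exact: xy.
by rewrite -(Quotient.idealrBE zint) => h; exact: h.
Qed.

Lemma piD (x y : R) : pi (x + y) = pi x + pi y.
Proof. by rewrite !piE. Qed.

Lemma piN (x : R) : pi (- x) = - pi x.
Proof. by rewrite !piE. Qed.

Lemma pi0 : pi 0 = 0.
Proof. by rewrite !piE. Qed.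

Lemma piMn (x : R) n : pi (x *+ n) = pi x *+ n.
Proof. by elim: n => [|n IHn]; rewrite ?mulr0n ?pi0 // !mulrS piD IHn. Qed.

Lemma frac01P (x y : R) : reflect (frac01 x = frac01 y) (x - y \is a Num.int).
Proof.
have fx := frac01_int x; have fy := frac01_int y.
apply: (iffP idP) => [xy|xy].
  apply: frac01_eq; have -> : x - (frac01 y : R) = (x - y) - ((frac01 y : R) - y) by ring.
  exact: rpredB.
have -> : x - y = ((frac01 y : R) - y) - ((frac01 x : R) - x) by rewrite xy; ring.
exact: rpredB.
Qed.

Lemma frac01K (y : ico01 R) : frac01 y = y.
Proof. by apply: frac01_eq; rewrite subrr. Qed.

Lemma frac01D (x y : R) : frac01 ((frac01 x : R) + y) = frac01 (x + y).
Proof.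
apply/frac01P; have -> : (frac01 x : R) + y - (x + y) = (frac01 x : R) - x by ring.
exact: frac01_int.
Qed.

Lemma rotation_frac01 (a : RmodZ R) (x : R) :
  rotation a (frac01 x) = frac01 (x + repr a).
Proof. exact: frac01D. Qed.

Lemma rotationM (a b : RmodZ R) : rotation (a + b) = (rotation a * rotation b)%g.
Proof.
apply: ietE => x; congr (ico01_val _).
rewrite -[x]frac01K [RHS](_ : _ = rotation b (rotation a (frac01 x))) //.
rewrite !rotation_frac01; apply/frac01P.
have -> : (x : R) + repr (a + b) - ((x : R) + repr a + repr b) =
  repr (a + b) - (repr a + repr b) by ring.
by apply/eq_piP; rewrite piD !reprK.
Qed.

End Torus.

(** * Action of interval exchanges on the fibres of multiplication by q *)

Section Fibres.
Variables (R : realType) (q : nat).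
Hypothesis q_gt0 : (0 < q)%N.
Local Open Scope quotient_scope.
Local Open Scope ring_scope.
Import Order.TTheory GRing.Theory Num.Theory.
Local Notation pi := (\pi_(RmodZ R)).

Let qR : 0 < q%:R :> R. Proof. by rewrite ltr0n. Qed.
Let qN0 : q%:R != 0 :> R. Proof. exact: lt0r_neq0. Qed.

(** Base points range over all reals, not only over [[0, 1 / q)]: rotations then
    move base points without permuting indices. *)
Definition fibre_pt (x : R) (i : 'I_q) : ico01 R := frac01 (x + i%:R / q%:R).

Lemma fibre_pt_int (x y : R) i :
  x - y \is a Num.int -> fibre_pt x i = fibre_pt y i.
Proof.
by move=> xy; apply/frac01P; have -> : x + i%:R / q%:R - (y + i%:R / q%:R) = x - y by ring.
Qed.

Lemma fibre_pt_inj (x : R) : injective (fibre_pt x).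
Proof.
move=> i j /frac01P.
have -> : x + i%:R / q%:R - (x + j%:R / q%:R) = (i%:R - j%:R) / q%:R :> R by ring.
case/intrP => n nE; apply: val_inj => /=.
have ij : (i%:Z - j%:Z)%R = n * q%:Z.
  by apply/eqP; rewrite -(eqr_int R) rmorphB rmorphM /= -nE divfK.
have [i_q j_q] := (ltn_ord i, ltn_ord j).
have [n_ge1|[n_leN1|n0]] : n >= 1 \/ (n <= -1 \/ n = 0) by lia.
- have : q%:Z <= n * q%:Z by rewrite ler_peMl.
  lia.
- have : q%:Z <= - n * q%:Z by rewrite ler_peMl // lerNr.
  lia.
- by move: ij; rewrite n0 mul0r; lia.
Qed.

(** Changing the base point inside a fibre is where [sigma] enters. *)
Lemma fibre_pt_ordS (x : R) i : fibre_pt (x + q%:R^-1) i = fibre_pt x (sigma q i).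
Proof.
rewrite permE; apply/frac01P => /=.
have iq := ltn_ord i; have := iq; rewrite leq_eqVlt => /orP[/eqP iE|iE].
  rewrite iE modnn.
  have -> : x + q%:R^-1 + i%:R / q%:R - (x + 0%:R / q%:R) = i.+1%:R / q%:R :> R.
    by rewrite -natr1; ring.
  by rewrite iE divff.
rewrite modn_small //.
by have -> : x + q%:R^-1 + i%:R / q%:R - (x + i.+1%:R / q%:R) = 0 :> R
  by rewrite -natr1; ring.
Qed.

(** Two translations that send one point to the same fibre differ by a multiple
    of [1 / q]. *)
Lemma fibre_pt_eq_shift (x r r' : R) i j :
  fibre_pt (x + r) i = fibre_pt (x + r') j -> pi r *+ q = pi r' *+ q.
Proof.
move/frac01P; have -> : x + r + i%:R / q%:R - (x + r' + j%:R / q%:R) =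
  (r - r') + (i%:R - j%:R) / q%:R by ring.
move=> rr; rewrite -!piMn; apply/eq_piP.
have -> : r *+ q - r' *+ q = ((r - r') + (i%:R - j%:R) / q%:R) *+ q - (i%:R - j%:R).
  by rewrite -[r *+ q]mulr_natr -[r' *+ q]mulr_natr -[(_ + _) *+ q]mulr_natr; field.
by rewrite rpredB ?rpredMn // rpredB ?natr_int.
Qed.

Section Monodromy.
Variables W D : {group 'S_q}.
Hypothesis nDW : W \subset 'N(D).

(** The permutation [tau] may vary with [x], but its class [u] modulo [D] may not.
    A relation, rather than [a] and [u] as functions of [h], can be checked on
    generators, as it is closed under products and inverses of the triples
    [(h, a, u)]. *)
Definition fibred (h : iet R) (a : RmodZ R) (u : coset_of D) : Prop :=
  exists2 r : R, pi r = a & forall x : R, exists tau : 'S_q,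
    [/\ tau \in W, coset D tau = u
      & forall i, h (fibre_pt x i) = fibre_pt (x + r) (tau i)].

Let NW t : t \in W -> t \in 'N(D). Proof. exact: (fintype.subsetP nDW). Qed.

Lemma fibred1 : fibred 1%g 0 1%g.
Proof.
exists 0; first exact: pi0.
move=> x; exists 1%g; split=> [||i]; rewrite ?group1 ?morph1 //.
by rewrite perm1 addr0.
Qed.

Lemma fibredM (h k : iet R) a b u v :
  fibred h a u -> fibred k b v -> fibred (h * k)%g (a + b) (u * v)%g.
Proof.
move=> [r <- hr] [t <- kt]; exists (r + t); first exact: piD.
move=> x; have [f [fW <- fE]] := hr x; have [g [gW <- gE]] := kt (x + r).
exists (f * g)%g; split=> [||i]; first exact: groupM.
  by rewrite morphM ?NW.
by rewrite permM addrA -gE -fE.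
Qed.

Lemma fibredV (h : iet R) a u : fibred h a u -> fibred h^-1%g (- a) u^-1%g.
Proof.
move=> [r <- hr]; exists (- r); first exact: piN.
move=> x; have [f [fW <- fE]] := hr (x - r).
exists f^-1%g; split=> [||i]; first by rewrite groupV.
  by rewrite morphV ?NW.
apply: (bij_inj (ietP h).1); rewrite fE subrK permKV.
exact: (congr1 (fun k : iet R => k (fibre_pt x i)) (mulVg h)).
Qed.

Lemma fibred_coset h a u : fibred h a u -> u \in (W / D)%g.
Proof. by case=> r _ /(_ 0)[f [fW <- _]]; exact: mem_quotient. Qed.

Lemma fibred_uniq h a b u v : fibred h a u -> fibred h b v -> a *+ q = b *+ q.
Proof.
move=> [r <- hr] [t <- ht]; have [f [_ _ fE]] := hr 0; have [g [_ _ gE]] := ht 0.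
pose i0 := Ordinal q_gt0.
apply: (@fibre_pt_eq_shift 0 r t (f i0) (g i0)).
by rewrite -fE gE.
Qed.

Lemma fibred_rotation a : fibred (rotation a) a 1%g.
Proof.
exists (repr a); first by rewrite reprK.
move=> x; exists 1%g; split=> [||i]; rewrite ?group1 ?morph1 //.
by rewrite perm1 rotation_frac01; congr frac01; ring.
Qed.

(** Such an [h] acts on each fibre by a permutation, whose order divides that of
    the symmetric group; the fibres cover the circle. *)
Lemma fibred_torsion h u : fibred h 0 u -> (h ^+ #|'S_q|)%g = 1%g.
Proof.
case=> r; rewrite -pi0 => /eq_piP; rewrite subr0 => r_int hr; apply: ietE => y.
have [f [_ _ fE]] := hr (y : R); pose i0 := Ordinal q_gt0.
have yE : y = fibre_pt y i0 by rewrite /fibre_pt mul0r addr0 frac01K.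
have hf i : h (fibre_pt y i) = fibre_pt y (f i).
  by rewrite fE; apply: fibre_pt_int; rewrite addrAC subrr add0r.
have pow n i : (h ^+ n)%g (fibre_pt y i) = fibre_pt y ((f ^+ n)%g i).
  elim: n => [|n IHn] in i *; first by rewrite !expg0 perm1.
  by rewrite !expgS permM -IHn -hf.
rewrite {1}yE pow -cardsT.
by rewrite expg_cardG ?inE // perm1 -yE.
Qed.

(** For a base point in the first cell, the index of a point of the fibre is the
    index of its cell. *)
Lemma fibre_pt_grid (tau : 'S_q) (x : R) i :
  0 <= x < q%:R^-1 -> grid R tau (fibre_pt x i) = fibre_pt x (tau i).
Proof.
move=> x01.
have cell j : x + j%:R / q%:R \in grid_cell R q j.
  rewrite in_itv /= -natr1 mulrDl; move: x01; lra.
have ptE j : (fibre_pt x j : R) = x + j%:R / q%:R.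
  have jx := grid_cell_sub (cell j).
  by rewrite /fibre_pt -[x + _]/(Ico01 jx : R) frac01K.
apply: val_inj.
transitivity ((fibre_pt x i : R) + grid_shift tau (fibre_pt x i : R)) => //.
by rewrite [RHS]ptE ptE (grid_shiftE _ (cell i)); ring.
Qed.

Hypothesis sigmaW : sigma q \in W.
Hypothesis derD : [~: W, W]%g \subset D.

(** On the fibre of a base point in the first cell, the permutation is [tau].
    Moving the base point by [1 / q] conjugates it by [sigma], which does not
    change the class modulo a subgroup containing the commutators of [W]. *)
Lemma fibred_grid tau : tau \in W -> fibred (grid R tau) 0 (coset D tau).
Proof.
move=> tW; exists 0; first exact: pi0.
pose C (x : R) := exists f : 'S_q, [/\ f \in W, coset D f = coset D tau
  & forall i, grid R tau (fibre_pt x i) = fibre_pt x (f i)].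
suff CP x : C x by move=> x; rewrite addr0; exact: CP.
have Cint (y z : R) : y - z \is a Num.int -> C y -> C z.
  move=> yz [f [fW fD fE]]; exists f; split=> // i.
  by rewrite -!(fibre_pt_int _ yz).
(* the new permutation is conjugate to the old one by [sigma], in [W] *)
have CS (y : R) : C y -> C (y + q%:R^-1).
  move=> [f [fW fD fE]]; exists (f ^ (sigma q)^-1)%g; split=> [||i].
  - by rewrite groupJ ?groupV.
  - have fs : [~ f, (sigma q)^-1]%g \in [~: W, W]%g by rewrite mem_commg ?groupV.
    have -> : (f ^ (sigma q)^-1 = f * [~ f, (sigma q)^-1])%g by rewrite commgEl mulKVg.
    rewrite morphM ?NW ?groupR ?groupV //= fD.
    by rewrite [coset D [~ _, _]]coset_id ?mulg1 //; exact: (fintype.subsetP derD).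
  - by rewrite !fibre_pt_ordS fE conjgE invgK !permM permKV.
have Cn n (y : R) : 0 <= y < q%:R^-1 -> C (y + n%:R / q%:R).
  elim: n => [|n IHn] in y * => y01.
    by rewrite mul0r addr0; exists tau; split=> // i; exact: fibre_pt_grid.
  by rewrite -natr1 mulrDl addrA mul1r; apply/CS/IHn.
apply: (Cint (frac01 x : R)); first exact: frac01_int.
move: (frac01 x) => y; have [i] := grid_cell_ex q_gt0 (valP y).
rewrite in_itv /= => xi; rewrite -(subrK (i%:R / q%:R) (y : R)).
by apply: Cn; move: xi; rewrite -natr1 mulrDl mul1r; lra.
Qed.

(** Over the base point [0], the indices are permuted by [tau] itself. *)
Lemma fibred_grid0 tau : fibred (grid R tau) 0 1%g -> tau \in D.
Proof.
case=> r; rewrite -pi0 => /eq_piP; rewrite subr0 => r_int /(_ 0)[f [fW fD fE]].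
suff -> : tau = f by apply: coset_idr fD; exact: NW.
apply/permP => i; apply: (@fibre_pt_inj 0).
rewrite -fibre_pt_grid ?lexx ?invr_gt0 // fE.
by apply: fibre_pt_int; rewrite add0r subr0.
Qed.

End Monodromy.
End Fibres.

(** * The group generated by rotations and grid permutations *)

Section Independent.
Variables (R : realType) (s : nat) (alpha : 'I_s -> RmodZ R).
Local Open Scope ring_scope.
Import Order.TTheory GRing.Theory Num.Theory.

Lemma groupA_comb (a : RmodZ R) : a \in groupA alpha ->
  exists n : 'I_s -> int, a = \sum_(i < s) alpha i *~ n i.
Proof.
move: a; apply: (@gensg_ind (Algebra.to_multiplicative (RmodZ R)) (range alpha)).
- by exists (fun=> 0); rewrite big1 // => i _; rewrite mulr0z.
- move=> _ _ [m ->] [n ->]; exists (fun i => m i + n i).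
  by rewrite -[LHS]big_split /=; apply: eq_bigr => i _; rewrite mulrzDr.
- move=> _ [m ->]; exists (fun i => - m i).
  by rewrite [LHS](raddf_sum -%R) /=; apply: eq_bigr => i _; rewrite mulrNz.
- move=> _ [j _ <-]; exists (fun i => (i == j)%:Z).
  rewrite (bigD1 j) //= eqxx big1 ?addr0 // => i /negbTE ->.
  by rewrite mulr0z.
Qed.

(** Multiplying a combination of the [alpha i] by [q] multiplies its coefficients
    by [q], so that independence kills them all. *)
Lemma groupA_torsion_free (a : RmodZ R) q : Q_independent alpha ->
  (0 < q)%N -> a \in groupA alpha -> a *+ q = 0 -> a = 0.
Proof.
move=> ind q0 /groupA_comb[n ->]; rewrite -sumrMnl => nq.
have /ind nq0 : \sum_(i < s) alpha i *~ (n i * q%:Z) = 0.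
  by rewrite -[RHS]nq; apply: eq_bigr => i _; rewrite mulrzA pmulrn.
rewrite big1 // => i _; have /eqP := nq0 i.
by rewrite mulf_eq0 -[q%:Z == 0]/(q == 0)%N (gtn_eqF q0) orbF => /eqP ->.
Qed.

End Independent.

Section RotationGrid.
Variables (R : realType) (s m q : nat) (alpha : 'I_s -> RmodZ R) (g : 'I_m -> iet R).
Hypotheses (q_gt0 : (0 < q)%N) (ind : Q_independent alpha).
Hypothesis g_grid : forall j, grid_group R q (g j).

Local Notation H := (sgroup (groupH alpha g)).
Local Notation A := (sgroup (groupA alpha)).
Local Notation SQ := (grid_perms_group q (groupQ g)).
Local Notation W := (groupW q (groupQ g)).
Local Notation D := [~: W, W]%G.

Let normD : W \subset 'N(D). Proof. by rewrite /= -derg1 der_norm. Qed.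
Let sigmaW : sigma q \in W. Proof. by rewrite mem_gen // !inE eqxx. Qed.
Let SQ_W tau : tau \in SQ -> tau \in W.
Proof. by move=> tQ; rewrite mem_gen // inE tQ orbT. Qed.

Local Notation fib := (fibred W (D := D)).

Lemma groupQ_sub_groupH : {subset groupQ g <= groupH alpha g}.
Proof. by apply: gensg_sub => x gx; apply: gensg_gen; right. Qed.

Lemma rotation_groupH a : a \in groupA alpha -> rotation a \in groupH alpha g.
Proof.
move: a; apply: (@gensg_ind (Algebra.to_multiplicative (RmodZ R)) (range alpha))
  => [|a b aH bH|a aH|_ [i _ <-]].
- suff -> : rotation (1 : Algebra.to_multiplicative (RmodZ R)) = 1 by exact: gpred1.
  by apply: (mulgI (rotation 0%R)); rewrite -rotationM GRing.addr0 mulg1.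
- by rewrite [rotation _]rotationM gpredM.
- suff -> : rotation (a^-1) = (rotation a)^-1 by exact: gpredVr.
  apply: (mulgI (rotation a)); rewrite -rotationM mulgV GRing.addrN.
  by apply: (mulgI (rotation 0%R)); rewrite -rotationM GRing.addr0 mulg1.
- by apply: gensg_gen; left; exists i.
Qed.

Lemma groupH_fibred (h : H) : exists (a : A) u, fib (\val h) (\val a) u.
Proof.
elim/sgroup_gensg_ind: h => [|x y [a [u xa]] [b [v yb]]|x [a [u xa]]|x].
- by exists 1, 1; exact: fibred1.
- by exists (a * b), (u * v); exact: fibredM.
- by exists a^-1, u^-1; exact: fibredV.
- move=> [[i _ xE]|[j _ xE]].
    have ai : alpha i \in groupA alpha by apply: gensg_gen; exists i.
    by exists (SGroup ai), 1; rewrite -xE; exact: fibred_rotation.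
  have [tau _ tE] := g_grid j; have gQ : g j \in groupQ g by apply: gensg_gen; exists j.
  exists 1, (coset D tau); rewrite -xE -tE; apply: fibred_grid => //.
  by apply: SQ_W; rewrite inE tE.
Qed.

(** The translation part is unique up to [q]-torsion, hence unique in [A]. *)
Lemma fibred_groupA_uniq h (a b : A) u v :
  fib h (\val a) u -> fib h (\val b) v -> a = b.
Proof.
move=> ha hb; apply/eqP; rewrite -divg_eq1; apply/eqP/val_inj.
apply: (groupA_torsion_free ind q_gt0 (sgroupP (a * b^-1))).
have ab := fibred_uniq q_gt0 ha hb.
by rewrite [_ (a * b^-1)](_ : _ = \val a - \val b)%R // GRing.mulrnBl ab GRing.subrr.
Qed.

Lemma groupH_translation : exists l : UMagmaMorphism.type H A,
  forall h, exists u, fib (\val h) (\val (l h)) u.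
Proof.
have [l lP] := choice groupH_fibred.
have lM : {morph l : x y / x * y}.
  move=> x y; have [[u xu] [v yv]] := (lP x, lP y); have [w xyw] := lP (x * y).
  have := fibredM normD xu yv.
  exact: (fibred_groupA_uniq (b := l x * l y) xyw).
have [l' l'E] := gmorph_of_mulM lM.
by exists l' => h; rewrite l'E; exact: lP.
Qed.

Lemma groupH_rotation_section :
  exists r : UMagmaMorphism.type A H, forall a, \val (r a) = rotation (\val a).
Proof.
pose r (a : A) : H := SGroup (rotation_groupH (sgroupP a)).
have rM : {morph r : a b / a * b} by move=> a b; apply: val_inj; exact: rotationM.
have [r' r'E] := gmorph_of_mulM rM.
by exists r' => a; rewrite r'E.
Qed.

(** The classes of index permutations lie in the commutative group
    [W / [~: W, W]], so those of commutators are trivial. *)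
Lemma derived_groupH_fibred (h : H) : h \in derived H -> fib (\val h) 0%R 1.
Proof.
have A0 : (0 + 0)%R = 0%R :> RmodZ R by rewrite GRing.addr0.
move: h; apply: gensg_ind.
- exact: fibred1.
- by move=> x y x1 y1; rewrite -A0 -[1]mulg1; exact: fibredM.
- by move=> x x1; rewrite -GRing.oppr0 -invg1; exact: fibredV.
- move=> _ [x [y ->]].
  have [a [u xa]] := groupH_fibred x; have [b [v yb]] := groupH_fibred y.
  have uv : [~ u, v] = 1.
    apply/eqP/commgP/(centsP (der_abelian 0 W)); last exact: fibred_coset yb.
    exact: fibred_coset xa.
  have := fibredM normD (fibredV normD xa)
            (fibredM normD (fibredV normD yb) (fibredM normD xa yb)).
  have -> : u^-1 * (v^-1 * (u * v)) = 1 by exact: uv.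
  by rewrite GRing.addrCA !GRing.addKr GRing.addNr.
Qed.

Lemma groupH_generated (r : A -> H) (e : 'S_q -> H) :
    (forall a, \val (r a) = rotation (\val a)) ->
    {in SQ, forall t, \val (e t) = grid R t} ->
  forall h : H, h \in gensg ([set e t | t in [set` SQ]] `|` range r)%classic.
Proof.
move=> rE eE; apply: sgroup_gensg_ind => [|x y xS yS|x xS|x].
- exact: gpred1.
- exact: gpredM.
- exact: gpredVr.
- move=> [[i _ xE]|[j _ xE]]; apply: gensg_gen.
    have ai : alpha i \in groupA alpha by apply: gensg_gen; exists i.
    by right; exists (SGroup ai) => //; apply: val_inj; rewrite rE.
  have [tau _ tE] := g_grid j; have gQ : g j \in groupQ g by apply: gensg_gen; exists j.
  have tQ : tau \in SQ by rewrite inE tE.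
  by left; exists tau => //; apply: val_inj; rewrite eE // tE.
Qed.

Lemma groupH_torsion (l : UMagmaMorphism.type H A) :
    (forall h, exists u, fib (\val h) (\val (l h)) u) ->
  kerg l =i torsion H.
Proof.
move=> lP h; apply/eqP/asboolP => [lh|[n n0 hn]].
  have [u] := lP h; rewrite lh => hu; exists #|'S_q|.
    by apply/card_gt0P; exists 1.
  apply: val_inj; rewrite -[RHS](fibred_torsion q_gt0 hu).
  by elim: #|_| => // k IHk; rewrite !expgS -IHk.
apply: val_inj; apply: (groupA_torsion_free ind n0 (sgroupP (l h))).
have ln : l h ^+ n = 1 by rewrite -gmulfXn hn gmulf1.
transitivity (\val (l h ^+ n)); last by rewrite ln.
by elim: n {n0 hn ln} => // k IHk; rewrite GRing.mulrS expgS IHk.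
Qed.

End RotationGrid.

Theorem theorem3 (R : realType) (s m q : nat)
    (hs : (0 < s)%N) (hm : (0 < m)%N) (hq : (0 < q)%N)
    (alpha : 'I_s -> RmodZ R)
    (alpha_irrational : forall i, ~ QmodZ (alpha i))
    (alpha_independent : Q_independent alpha)
    (g : 'I_m -> iet R) (g_grid : forall j, grid_group R q (g j)) :
  (exists T : normalClosed (sgroup (groupH alpha g)),
     [/\ T =i torsion (sgroup (groupH alpha g)),
         group_iso (quotg T) (sgroup (groupA alpha))
       & exists phi : autaction (sgroup (groupA alpha)) (sgroup T),
           group_iso (sgroup (groupH alpha g)) (semidirect phi)])
  /\
  (exists N : {group 'S_q},
     let SQ := grid_perms_group q (groupQ g) in
     let W := groupW q (groupQ g) in
     let F := (SQ / N)%G in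
     [/\ N <| SQ,
         [~: SQ, SQ] \subset N,
         N \subset [~: W, W] :&: SQ,
         group_iso (quotg (derived (sgroup (groupH alpha g))))
                   (subg_of F * sgroup (groupA alpha))%type
       & abelian F]).
Proof.
have [l lP] := groupH_translation hq alpha_independent g_grid.
have [r rE] := groupH_rotation_section alpha g.
set W := groupW q (groupQ g); set SQ := grid_perms_group q (groupQ g).
have lE h (a : sgroup (groupA alpha)) (u : coset_of [~: W, W]%G) :
    fibred W h (\val a) u -> forall x, \val x = h -> l x = a.
  move=> ha x xh; have [v] := lP x; rewrite xh => hv.
  exact: fibred_groupA_uniq hv ha.
have rK : cancel r l by move=> a; apply: lE (rE a); exact: fibred_rotation.
split.
  pose T : normalClosed (sgroup (groupH alpha g)) := kerg l.
  exists T; split; first exact: groupH_torsion hq alpha_independent _ lP.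
    exact: split_quotient rK.
  by exists (split_act l r); exact: split_semidirect.
pose e (t : 'S_q) : sgroup (groupH alpha g) := insubd 1 (grid R t).
have eE : {in SQ, forall t, \val (e t) = grid R t}.
  by move=> t; rewrite inE => tQ; rewrite insubdK //; exact: groupQ_sub_groupH.
have eM : {in SQ &, {morph e : x y / x * y}}.
  move=> x y xQ yQ; apply: val_inj; rewrite valM !eE ?groupM //; exact: gridM.
have SQW t : t \in SQ -> t \in W by move=> tQ; rewrite mem_gen // inE tQ orbT.
have sW : sigma q \in W by rewrite mem_gen // !inE eqxx.
have nW : W \subset 'N([~: W, W]%G) by rewrite /= -derg1 der_norm.
have le1 : {in SQ, forall t, l (e t) = 1}.
  move=> t tQ; have fib_t := fibred_grid R hq nW sW (fintype.subxx _) (SQW _ tQ).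
  exact: (@lE _ 1 _ fib_t _ (eE _ tQ)).
have comA (a b : sgroup (groupA alpha)) : commute a b.
  by apply: val_inj; exact: GRing.addrC.
have gen := groupH_generated g_grid rE eE.
exists (derived_preim_group eM); split.
- exact: derived_preim_normal.
- exact: derived_preim_comm.
- apply/fintype.subsetP => t; rewrite inE => /andP[tQ tD].
  rewrite finset.inE tQ andbT; apply: (fibred_grid0 (R := R) hq nW).
  by rewrite -eE //; exact: derived_groupH_fibred.
- exact: (split_abelianization rK eM le1 comA gen).
- exact: derived_preim_abelian.
Qed.
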